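(* Let $\Psi:(0,+\infty)\to(0,+\infty)$ be a non-decreasing convex function. Assume that $\Psi^*(x):=\sup_{y\in(0,+\infty)}(xy-\Psi(y))$ is a bijection from $(0,+\infty)$ to $(0,+\infty)$, and that $B$ is a non-negative symmetric operator on $L^2(\mu)$ satisfying a super-Poincaré inequality with some rate function $\gamma:(0,+\infty)\to(0,+\infty)$, i.e. for every $f\in\mathcal D(B)\cap L^1(\mu)$, $$\|f\|_2^2\le r\,(Bf,f)+\gamma(r)\,\|f\|_1^2\qquad\text{for all } r>0.$$ Then $\Psi(B)$ also satisfies a super-Poincaré inequality, with rate function $$\gamma_\Psi(t)=\inf_{0<\varepsilon<1}\ \frac1\varepsilon\,\gamma\left(\varepsilon t\,(\Psi^* )^{-1}\left(\frac{1-\varepsilon}{\varepsilon t}\right)\right),\qquad t>0,$$ i.e. for every $f\in\mathcal D(\Psi(B))\cap L^1(\mu)$ and every $t>0$, $\|f\|_2^2\le t\,(\Psi(B)f,f)+\gamma_\Psi(t)\,\|f\|_1^2$. In particular, if $\Psi(x)=x^{1/\alpha}$ with $\alpha\in(0,1)$, then $\gamma_\Psi(t)\le\frac1\alpha\,\gamma(t^\alpha)$ for all $t>0$.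
   Context: $(X,\mu)$ is a $\sigma$-finite measure space, $(\cdot,\cdot)$ is the inner product of $L^2(\mu)$ and $\|\cdot\|_p$ the $L^p(\mu)$-norm. A non-negative, densely defined symmetric operator is not distinguished from its self-adjoint Friedrichs extension, so $B$ is regarded as a non-negative self-adjoint operator with spectral resolution $(E_\lambda)$. $\Psi(B)=\int_0^{+\infty}\Psi(\lambda)\,dE_\lambda$, with $\Psi(0):=\Psi(0^+)$, on the domain $\mathcal D(\Psi(B))=\{f\in L^2:\int_0^{+\infty}|\Psi(\lambda)|^2d(E_\lambda f,f)<\infty\}$. *)

(* Defs.v *)
From HB Require Import structures.
From mathcomp Require Import all_boot all_order all_algebra.
From mathcomp Require Import all_classical all_reals all_analysis.
From mathcomp Require Import measurable_realfun.

Set Implicit Arguments.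
Unset Strict Implicit.
Unset Printing Implicit Defensive.

Import Order.TTheory GRing.Theory Num.Theory.
Import numFieldNormedType.Exports.

Local Open Scope classical_set_scope.
Local Open Scope ring_scope.

(* Elements of L^2(mu) are represented by square-integrable functions; all the
   notions below are invariant under equality mu-almost everywhere. *)
Notation L2 mu := (LfunType mu (lee1n 2)).

Section operators.
Context {d : measure_display} {X : measurableType d} {R : realType}.
Variable mu : {measure set X -> \bar R}.
Implicit Types f g h : L2 mu.

Definition inner f g : R := \int[mu]_x (f x * g x).

Definition norm1 (f : X -> R) : R := fine 'N[mu]_1[EFin \o f].

Definition norm2 (f : X -> R) : R := fine 'N[mu]_2%:E[EFin \o f].

Lemma inner_integrable f g :
  mu.-integrable setT (EFin \o (fun x => f x * g x)).
Proof.
apply/Lfun1_integrable.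
exact: (Lfun2_mul_Lfun1 (LfunP f) (LfunP g)).
Qed.

Lemma innerC f g : inner f g = inner g f.
Proof. by rewrite /inner; under eq_Rintegral do rewrite mulrC. Qed.

Lemma innerBl f g h : inner (f - g) h = inner f h - inner g h.
Proof.
rewrite /inner -RintegralB//; [|exact: inner_integrable..].
by apply: eq_Rintegral => x _; rewrite -mulrBl.
Qed.

Lemma innerBr f g h : inner h (f - g) = inner h f - inner h g.
Proof. by rewrite innerC innerBl !(innerC h). Qed.

Lemma inner_ge0 f : 0 <= inner f f.
Proof. by apply: Rintegral_ge0 => x _; rewrite -expr2 sqr_ge0. Qed.

Lemma eq_inner_ae f f' g : f = f' %[ae mu] -> inner f g = inner f' g.
Proof.
move=> ff'; rewrite /inner /Rintegral; congr fine.
apply: ae_eq_integral => //.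
- by apply/measurable_EFinP; apply: measurable_funM.
- by apply/measurable_EFinP; apply: measurable_funM.
- by apply: filterS ff' => x /(_ I) -> _.
Qed.

Lemma norm2_ge0 f : 0 <= norm2 f.
Proof. by rewrite fine_ge0// Lnorm_ge0. Qed.

Lemma cauchy_schwarz f g : `|inner f g| <= norm2 f * norm2 g.
Proof.
have ifg := inner_integrable f g.
apply: (le_trans (le_normr_Rintegral measurableT ifg)).
rewrite -lee_fin EFinM /norm2 !finite_norm_fine.
have p2 : 2^-1 + 2^-1 = 1 :> R by rewrite [RHS]splitr !div1r.
have mf : measurable_fun setT f by [].
have mg : measurable_fun setT g by [].
apply: le_trans (hoelder mu mf mg (ltr0Sn _ 1) (ltr0Sn _ 1) p2).
rewrite Lnorm1 /Rintegral fineK//.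
by apply: integrable_fin_num => //; exact: integrable_norm.
Qed.

(* A linear operator in L^2(mu) whose domain is a linear subspace; [app] is
   irrelevant outside [dom]. *)
Record operator := Operator {
  dom : set (L2 mu) ;
  app :> L2 mu -> L2 mu ;
  dom_ae : forall f g, f = g %[ae mu] -> dom f -> dom g ;
  app_ae : forall f g, f = g %[ae mu] -> dom f -> app f = app g %[ae mu] ;
  dom0 : dom 0 ;
  dom_lin : forall (a : R) f g, dom f -> dom g -> dom (a *: f + g) ;
  app_lin : forall (a : R) f g, dom f -> dom g ->
    app (a *: f + g) = (a *: app f + app g : L2 mu) %[ae mu] }.

Definition densely_defined (A : operator) :=
  forall f (e : R), 0 < e -> exists2 g, dom A g & norm2 (f - g) < e.

(* [(g, h)] belongs to the graph of the adjoint of [A]. *)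
Definition adjoint_graph (A : operator) g h :=
  forall f, dom A f -> inner (A f) g = inner f h.

Definition self_adjoint (A : operator) :=
  densely_defined A /\
  forall g h, adjoint_graph A g h <-> (dom A g /\ A g = h %[ae mu]).

Definition nonneg_operator (A : operator) :=
  forall f, dom A f -> 0 <= inner (A f) f.

(* A resolution of the identity on [0, +oo[ (extended by 0 to the negative
   reals, so that [E_0] is the mass that the spectral measures put at 0). *)
Record resolution := Resolution {
  proj :> R -> L2 mu -> L2 mu ;
  proj_lin : forall l (a : R) f g,
    proj l (a *: f + g) = (a *: proj l f + proj l g : L2 mu) %[ae mu] ;
  proj_sym : forall l f g, inner (proj l f) g = inner f (proj l g) ;
  proj_min : forall l m f,
    proj l (proj m f) = proj (Num.min l m) f %[ae mu] ;
  proj_right : forall l f, norm2 (proj m f - proj l f) @[m --> l^'+] --> 0 ;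
  proj_neg : forall l f, l < 0 -> proj l f = (0 : L2 mu) %[ae mu] ;
  proj_pinfty : forall f, norm2 (proj l f - f) @[l --> +oo] --> 0 }.

Definition spectral_fun (E : resolution) f (l : R) : R := inner (E l f) f.

Section spectral_fun.
Variables (E : resolution) (f : L2 mu).

Lemma inner_proj l g : inner (E l g) (E l g) = inner (E l g) g.
Proof.
by rewrite proj_sym innerC; apply: eq_inner_ae;
  have := proj_min E l l g; rewrite minxx.
Qed.

Lemma inner_proj_le l g : inner (E l g) g <= inner g g.
Proof.
have := inner_ge0 (g - E l g).
rewrite innerBl !innerBr inner_proj (innerC g (E l g)).
by rewrite subrr subr0 subr_ge0.
Qed.

Lemma spectral_fun_nondecreasing : nondecreasing (spectral_fun E f).
Proof.
move=> l m lm; rewrite /spectral_fun -(inner_proj l) -(inner_proj m).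
have Elm : E l (E m f) = E l f %[ae mu].
  by have := proj_min E l m f; rewrite min_l.
rewrite -(eq_inner_ae _ Elm) innerC -(eq_inner_ae _ Elm) inner_proj.
exact: inner_proj_le.
Qed.

Lemma spectral_fun_right_continuous : right_continuous (spectral_fun E f).
Proof.
move=> l; apply/subr_cvg0.
have h : norm2 (E m f - E l f) * norm2 f @[m --> l^'+] --> 0.
  by rewrite -(mul0r (norm2 f)); apply: cvgMl; exact: proj_right.
apply: squeeze_cvgr; [|by rewrite -oppr0; exact: cvgN h|exact: h].
apply: nearW => m.
by rewrite -ler_norml /spectral_fun -innerBl cauchy_schwarz.
Qed.

HB.instance Definition _ := isCumulative.Build R _ R (spectral_fun E f)
  spectral_fun_nondecreasing spectral_fun_right_continuous.

End spectral_fun.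

(* d(E_l f, f) *)
Definition spectral_measure (E : resolution) f :=
  lebesgue_stieltjes_measure (spectral_fun E f).

(* The integral of [h] over [0, +oo[ with respect to the signed measure
   d(E_l f, g), which is defined by polarization. *)
Definition spectral_form (E : resolution) (h : R -> R) f g : R :=
  4^-1 * (\int[spectral_measure E (f + g)]_(l in `[0, +oo[) h l
        - \int[spectral_measure E (f - g)]_(l in `[0, +oo[) h l).

(* The pairings with the elements of [dom A] determine [A f] almost everywhere,
   because the domain of such an integral is dense. *)
Definition is_spectral_integral (E : resolution) (h : R -> R) (A : operator) :=
  (forall f, dom A f <->
    (\int[spectral_measure E f]_(l in `[0%R, +oo[) (`|h l| ^+ 2)%:E < +oo)%E) /\
  (forall f g, dom A f -> dom A g -> inner (A f) g = spectral_form E h f g).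

Definition spectral_resolution (E : resolution) (B : operator) :=
  is_spectral_integral E id B.

Definition super_poincare (A : operator) (gamma : R -> R) :=
  forall f, dom A f -> (f : X -> R) \in Lfun mu 1 ->
  forall r, 0 < r ->
    norm2 f ^+ 2 <= r * inner (A f) f + gamma r * norm1 f ^+ 2.

End operators.

Section rate.
Context {R : realType}.
Implicit Types (Psi gamma : R -> R).

Definition ext0 Psi (l : R) : R :=
  if 0 < l then Psi l else lim (Psi y @[y --> 0^'+]).

Definition is_functional_calculus {d} {X : measurableType d}
    {mu : {measure set X -> \bar R}} (E : resolution mu) Psi
    (A : operator mu) :=
  is_spectral_integral E (ext0 Psi) A.

Definition legendre Psi (x : R) : \bar R :=
  ereal_sup [set (x * y - Psi y)%:E | y in `]0, +oo[%classic].

(* The inverse of [legendre Psi] on ]0, +oo[. *)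
Definition legendre_inv Psi (z : R) : R :=
  'pinv_(fun=> 0) `]0, +oo[%classic (legendre Psi) z%:E.

Definition rate Psi gamma (t : R) : R :=
  inf [set e^-1 * gamma (e * t * legendre_inv Psi ((1 - e) / (e * t))) |
       e in `]0, 1[%classic].

End rate.

(* Main.v *)
Require Import Defs.
From HB Require Import structures.
From mathcomp Require Import all_boot all_order all_algebra.
From mathcomp Require Import all_classical all_reals all_analysis.
From mathcomp Require Import measurable_realfun ring lra.

Set Implicit Arguments.
Unset Strict Implicit.
Unset Printing Implicit Defensive.

Import Order.TTheory GRing.Theory Num.Theory.
Import numFieldNormedType.Exports.

Local Open Scope classical_set_scope.
Local Open Scope ring_scope.

(** Everything follows from the Fenchel-Young inequality
      x * l <= Psi l + z,   where z := Psi^* x,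
    read under the spectral integral.  Integrating it against the spectral
    measure of f, whose total mass is at most the squared norm of f, gives
      x (B f, f) <= (Psi(B) f, f) + z ||f||^2
    ([inner_functional_calculus_ge]); squaring it shows first that f belongs to
    the domain of B as soon as it belongs to that of Psi(B)
    ([functional_calculus_dom]).  Inserting this bound in the super-Poincare
    inequality of B at the parameter r := e * t * x, with x chosen so that
    z = (1 - e) / (e * t), makes the coefficient of ||f||^2 on the right equal
    to 1 - e; absorbing that term in the left-hand side and dividing by e gives
      ||f||^2 <= t (Psi(B) f, f) + e^-1 gamma(r) ||f||_1^2,
    and it remains to take the infimum over e.

    The form (A f, f) is defined by polarization, so it is an integral against
    the spectral measure of f + f, up to the one of 0, which vanishes.  The
    estimates are therefore made directly for f + f and divided by 4, which
    avoids comparing the spectral measures of f and of f + f.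

    For Psi l = l^(1/alpha), Young's inequality computes Psi^* explicitly; the
    choice e := alpha in the infimum yields r = t^alpha. *)

(** * Inner products *)

Section inner_product.
Context {d : measure_display} {X : measurableType d} {R : realType}.
Variable mu : {measure set X -> \bar R}.
Implicit Types f g : L2 mu.

Lemma norm2_sqr f : norm2 mu f ^+ 2 = inner f f.
Proof.
have normE : (norm2 mu f `^ 2)%:E = (\int[mu]_x (f x * f x)%:E)%E.
  rewrite -poweR_EFin /norm2 finite_norm_fine poweR_Lnorm//.
  apply: eq_integral => x _ /=.
  by rewrite powR_mulrn// real_normK ?num_real// expr2.
by rewrite /inner /Rintegral -normE /= powR_mulrn// norm2_ge0.
Qed.

Lemma inner0l g : inner (0 : L2 mu) g = 0.
Proof. by rewrite -(subrr (0 : L2 mu)) innerBl subrr. Qed.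

Lemma inner_double f : inner (f + f) (f + f) = 4 * inner f f.
Proof.
have E : f + f = f - (0 - f) by rewrite sub0r opprK.
by rewrite E !(innerBl, innerBr) !(innerC _ 0) !inner0l; ring.
Qed.

End inner_product.

(** * Total mass of the spectral measures *)

Section spectral_mass.
Context {d : measure_display} {X : measurableType d} {R : realType}.
Variables (mu : {measure set X -> \bar R}) (E : resolution mu).
Implicit Types (f : L2 mu) (h : R -> R).

Lemma spectral_measure_itv_oc f (a b : R) : a <= b ->
  spectral_measure E f `]a, b] =
  (spectral_fun E f b - spectral_fun E f a)%:E.
Proof.
move=> ab; rewrite /spectral_measure /lebesgue_stieltjes_measure.
rewrite /measure_extension measurable_mu_extE/=; last exact: is_ocitv.
by rewrite wlength_itv_bnd.
Qed.

(** [0, +oo[ is covered by the increasing intervals ]-1, n], whose masses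
    (E_n f, f) - (E_(-1) f, f) never exceed (f, f) because E_n is a
    projection. *)
Lemma spectral_mass_le f :
  (spectral_measure E f `[0%R, +oo[ <= (inner f f)%:E)%E.
Proof.
pose F n : set (measurableTypeR R) := `](-1), n%:R]%classic.
have mF n : measurable (F n) by exact: measurable_itv.
have mUF : measurable (\bigcup_n F n) by exact: bigcup_measurable.
apply: (@le_trans _ _ (spectral_measure E f (\bigcup_n F n))).
  apply: le_measure; rewrite ?inE//.
  move=> x /=; rewrite in_itv/= andbT => x0.
  exists (Num.truncn x).+1 => //=.
  rewrite /F/= in_itv/= (lt_le_trans _ x0) ?ltrN10//=.
  by rewrite ltW// truncnS_gt.
have ndF : {homo F : n m / (n <= m)%N >-> (n <= m)%O}.
  move=> n m nm; apply/subsetPset => x; rewrite /F/= !in_itv/=.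
  move=> /andP[-> xn] /=.
  by rewrite (le_trans xn)// ler_nat.
have cF := @nondecreasing_cvg_mu _ _ _ (spectral_measure E f) F mF mUF ndF.
have <- : limn (spectral_measure E f \o F) =
    spectral_measure E f (\bigcup_n F n).
  exact/cvg_lim.
apply: lime_le; first by apply/cvg_ex; eexists; exact: cF.
apply: nearW => n /=.
rewrite spectral_measure_itv_oc; last by rewrite (le_trans (lerN10 _)).
rewrite lee_fin lerBlDr.
rewrite (le_trans (inner_proj_le E _ f))// lerDl.
by rewrite /spectral_fun -inner_proj inner_ge0.
Qed.

Lemma spectral_mass_lty f : (spectral_measure E f `[0%R, +oo[ < +oo)%E.
Proof. exact: le_lt_trans (spectral_mass_le f) (ltry _). Qed.

Lemma Rintegral_spectral_measure0 f h :
  measurable_fun (`[0, +oo[ : set R) h -> inner f f = 0 ->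
  \int[spectral_measure E f]_(l in `[0, +oo[) h l = 0.
Proof.
move=> /measurable_EFinP mh f0.
rewrite /Rintegral null_set_integral//; apply/eqP; rewrite eq_le measure_ge0.
by have := spectral_mass_le f; rewrite f0 andbT.
Qed.

(** On the diagonal, one of the two terms of the polarization formula is the
    integral against the spectral measure of f - f = 0, which is null. *)
Lemma spectral_form_diag h f : measurable_fun (`[0, +oo[ : set R) h ->
  spectral_form E h f f =
  4^-1 * \int[spectral_measure E (f + f)]_(l in `[0, +oo[) h l.
Proof.
move=> mh; rewrite /spectral_form; congr (_ * _).
rewrite -[RHS]subr0; congr (_ - _).
by apply: Rintegral_spectral_measure0 => //; rewrite subrr inner0l.
Qed.

End spectral_mass.

(** * Affine domination of functions on a set of finite measure *)

Section domination.
Context {d : measure_display} {T : measurableType d} {R : realType}.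
Variables (nu : {measure set T -> \bar R}) (D : set T).
Hypotheses (mD : measurable D) (nuD : (nu D < +oo)%E).
Variables (g h : T -> R) (x z : R).
Hypotheses (mg : measurable_fun D g) (mh : measurable_fun D h).
Hypotheses (g_ge0 : forall l, D l -> 0 <= g l).
Hypotheses (h_ge0 : forall l, D l -> 0 <= h l).
Hypotheses (x_gt0 : 0 < x) (gh : forall l, D l -> x * h l <= g l + z).

Lemma integrable_cst_lty (c : R) : nu.-integrable D (EFin \o (fun=> c)).
Proof.
apply: measurable_bounded_integrable => //.
by exists `|c|; split; [exact: num_real|move=> M cM l _; exact: ltW].
Qed.

Lemma le_integrable_real (u v : T -> R) :
  measurable_fun D u -> (forall l, D l -> `|u l| <= v l) ->
  nu.-integrable D (EFin \o v) -> nu.-integrable D (EFin \o u).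
Proof.
move=> mu uv iv; apply: (le_integrable mD _ _ iv); first exact/measurable_EFinP.
by move=> l Dl /=; rewrite lee_fin (le_trans (uv _ Dl))// ler_norm.
Qed.

Hypothesis g2 : (\int[nu]_(l in D) (`|g l| ^+ 2)%:E < +oo)%E.

Let ig2 : nu.-integrable D (EFin \o (fun l => g l ^+ 2)).
Proof.
apply/integrableP; split.
  by apply/measurable_EFinP; exact: measurable_funX.
by under eq_integral do rewrite /= normrX.
Qed.

(** x^2 h^2 <= (g + z)^2 <= 2 g^2 + 2 z^2, and the constant is integrable
    because [D] has finite measure. *)
Lemma dominated_sqr_lty : (\int[nu]_(l in D) (`|h l| ^+ 2)%:E < +oo)%E.
Proof.
pose v l := 2 / x ^+ 2 * g l ^+ 2 + 2 * z ^+ 2 / x ^+ 2.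
have iv : nu.-integrable D (EFin \o v).
  rewrite (_ : EFin \o v = (fun l => (2 / x ^+ 2)%:E * (g l ^+ 2)%:E)%E \+
     (EFin \o (fun=> 2 * z ^+ 2 / x ^+ 2)%R))%E.
    apply: integrableD => //; last exact: integrable_cst_lty.
    exact: integrableZl.
  by apply/funext => l /=; rewrite -EFinM.
have : nu.-integrable D (EFin \o (fun l => h l ^+ 2)).
  apply: le_integrable_real iv; first exact: measurable_funX.
  move=> l Dl; rewrite ger0_norm ?sqr_ge0// /v.
  rewrite mulrAC -mulrDl ler_pdivlMr ?exprn_gt0//.
  have xh0 : 0 <= x * h l by rewrite mulr_ge0 ?h_ge0 ?ltW.
  have := lerXn2r 2 xh0 (le_trans xh0 (gh Dl)) (gh Dl).
  have := sqr_ge0 (g l - z); lra.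
move=> /integrableP[_].
by under eq_integral do rewrite /= normrX.
Qed.

Lemma dominated_Rintegral :
  x * \int[nu]_(l in D) h l <= \int[nu]_(l in D) g l + z * fine (nu D).
Proof.
(* On a finite measure space L^2 is contained in L^1, by g <= g^2 + 1. *)
have ig : nu.-integrable D (EFin \o g).
  apply: (@le_integrable_real _ (fun l => g l ^+ 2 + 1)) => //.
    move=> l Dl; rewrite ger0_norm ?g_ge0//.
    have := sqr_ge0 (g l - 1); have := sqr_ge0 (g l); nra.
  rewrite (_ : EFin \o _ = (EFin \o (fun l => g l ^+ 2)%R) \+
    (EFin \o (fun=> 1%R)))%E//.
  by apply: integrableD => //; exact: integrable_cst_lty.
have igz : nu.-integrable D (EFin \o (fun l => g l + z)).
  rewrite (_ : EFin \o _ = (EFin \o g) \+ (EFin \o (fun=> z)))%E//.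
  by apply: integrableD => //; exact: integrable_cst_lty.
have ixh : nu.-integrable D (EFin \o (fun l => x * h l)).
  apply: le_integrable_real igz; first exact: measurable_funM.
  by move=> l Dl; rewrite ger0_norm ?gh// mulr_ge0 ?h_ge0 ?ltW.
have ih : nu.-integrable D (EFin \o h).
  rewrite (_ : EFin \o h = (fun l => x^-1%:E * (x * h l)%:E)%E).
    exact: integrableZl.
  by apply/funext => l /=; rewrite -EFinM mulKf ?gt_eqF.
rewrite -RintegralZl// -Rintegral_cst// -RintegralD//; last first.
  exact: integrable_cst_lty.
exact: le_Rintegral.
Qed.

End domination.

(** * Convex conjugates *)

Section convex_conjugate.
Context {R : realType}.
Implicit Types (Psi gamma : R -> R).

Lemma fenchel_young Psi (x y z : R) : legendre Psi x = z%:E -> 0 < y ->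
  x * y <= Psi y + z.
Proof.
move=> xz y0; rewrite addrC -lerBlDr -lee_fin -xz.
by apply: ereal_sup_ubound; exists y => //=; rewrite in_itv/= andbT.
Qed.

(** [legendre_inv Psi z] takes a default value outside the image of
    [legendre Psi]; any preimage [x] of [z] certifies that it is meaningful. *)
Lemma legendre_inv_spec Psi (x z : R) : 0 < x -> legendre Psi x = z%:E ->
  0 < legendre_inv Psi z /\ legendre Psi (legendre_inv Psi z) = z%:E.
Proof.
move=> x0 xz.
have sz : set_surj `]0, +oo[%classic [set z%:E] (legendre Psi).
  by move=> _ ->; exists x => //=; rewrite in_itv/= andbT.
split; last by apply: (surjpK _ sz); rewrite inE.
have /(_ (legendre_inv Psi z)) := surjpinv_image_sub (dflt := fun=> 0) sz.
by rewrite /= in_itv/= andbT; apply; exists z%:E.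
Qed.

Section ext0.
Variable Psi : R -> R.
Hypothesis Psi_gt0 : forall x, 0 < x -> 0 < Psi x.
Hypothesis Psi_nd : {in `]0, +oo[%classic &, {homo Psi : x y / x <= y}}.

Let cvg_Psi0 : cvg (Psi y @[y --> 0^'+]).
Proof.
apply: nondecreasing_at_right_is_cvgr; apply: nearW => e.
  move=> x y; rewrite !in_itv/= => /andP[x0 _] /andP[y0 _].
  by apply: Psi_nd; rewrite inE/= in_itv/= andbT.
exists 0 => v [y] /=; rewrite in_itv/= => /andP[y0 _] <-.
exact/ltW/Psi_gt0.
Qed.

Lemma ext0_ge0 y : 0 <= ext0 Psi y.
Proof.
rewrite /ext0; case: ifPn => [/Psi_gt0/ltW//|_].
apply: limr_ge => //; near=> e.
by apply/ltW/Psi_gt0; near: e; exact: nbhs_right_gt.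
Unshelve. all: by end_near. Qed.

Lemma ext0_nondecreasing : nondecreasing (ext0 Psi).
Proof.
move=> x y xy; rewrite /ext0; case: (ltP 0 x) => [x0|x0].
  have y0 := lt_le_trans x0 xy.
  by rewrite y0; apply: Psi_nd; rewrite ?inE/= ?in_itv/= ?andbT.
case: ltP => // y0; apply: limr_le => //; near=> e.
have e0 : 0 < e by near: e; exact: nbhs_right_gt.
apply: Psi_nd; rewrite ?inE/= ?in_itv/= ?andbT//.
by near: e; exact: nbhs_right_le.
Unshelve. all: by end_near. Qed.

(** At [y = 0] the inequality only says that the limit of Psi at 0 and [z] have
    a nonnegative sum. *)
Lemma fenchel_young_ext0 (x y z : R) : 0 <= z -> legendre Psi x = z%:E ->
  0 <= y -> x * y <= ext0 Psi y + z.
Proof.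
move=> z0 xz; rewrite le_eqVlt => /predU1P[<-|y0].
  by rewrite mulr0 addr_ge0// ext0_ge0.
by rewrite /ext0 y0; exact: fenchel_young.
Qed.

End ext0.

(** With x = w^(1-alpha) / alpha, the upper bound is Young's inequality for
    w^(1-alpha) and y with the conjugate exponents 1/(1-alpha) and 1/alpha;
    equality holds at y = w^alpha.  Parametrizing by [w] makes the conjugate
    linear, so that its inverse is read off directly. *)
Lemma legendre_powR (alpha w : R) : 0 < alpha < 1 -> 0 < w ->
  legendre (fun x => x `^ alpha^-1) (alpha^-1 * w `^ (1 - alpha)) =
  (w * (1 - alpha) / alpha)%:E.
Proof.
move=> /andP[a0 a1] w0; have a'0 : 0 < 1 - alpha by rewrite subr_gt0.
apply/eqP; rewrite eq_le; apply/andP; split.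
  apply: ge_ereal_sup => v [y] /=; rewrite in_itv/= andbT => y0 <-.
  rewrite lee_fin.
  have wy : w `^ (1 - alpha) * y <= w * (1 - alpha) + y `^ alpha^-1 * alpha.
    have p0 : 0 < (1 - alpha)^-1 by rewrite invr_gt0.
    have q0 : 0 < alpha^-1 by rewrite invr_gt0.
    have pq : (1 - alpha)^-1^-1 + alpha^-1^-1 = 1 by rewrite !invrK subrK.
    have := conjugate_powR (powR_ge0 w (1 - alpha)) (ltW y0) p0 q0 pq.
    by rewrite -powRrM divff ?gt_eqF// powRr1 ?(ltW w0)// !invrK.
  rewrite ler_pdivlMr// mulrBl lerBlDr (le_trans _ wy)// le_eqVlt.
  by apply/orP; left; apply/eqP; field; rewrite gt_eqF.
apply: ereal_sup_ubound; exists (w `^ alpha) => /=.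
  by rewrite in_itv/= andbT powR_gt0.
have ww : w `^ (1 - alpha) * w `^ alpha = w.
  by rewrite -powRD ?(gt_eqF w0) ?implybT// subrK powRr1 ?ltW.
rewrite -(mulrA alpha^-1) ww -powRrM divff ?gt_eqF// powRr1 ?ltW//.
by congr EFin; field; rewrite gt_eqF.
Qed.

Lemma legendre_inv_powR (alpha w : R) : 0 < alpha < 1 -> 0 < w ->
  legendre_inv (fun x => x `^ alpha^-1) (w * (1 - alpha) / alpha) =
  alpha^-1 * w `^ (1 - alpha).
Proof.
move=> a01 w0; have /andP[a0 a1] := a01.
have a'0 : 0 < 1 - alpha by rewrite subr_gt0.
rewrite /legendre_inv -legendre_powR// pinvKV//; last first.
  by rewrite inE/= in_itv/= andbT mulr_gt0 ?invr_gt0 ?powR_gt0.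
(* Every positive x is of the form w^(1-alpha) / alpha, so the injectivity of
   the conjugate reduces to that of a linear function of w. *)
have param (x : R) : 0 < x ->
    exists2 v, 0 < v & x = alpha^-1 * v `^ (1 - alpha).
  move=> x0; exists ((alpha * x) `^ (1 - alpha)^-1).
    by rewrite powR_gt0// mulr_gt0.
  rewrite -powRrM mulVf ?gt_eqF// powRr1 ?mulKf ?gt_eqF//.
  by rewrite ltW// mulr_gt0.
move=> x y; rewrite !inE/= !in_itv/= !andbT => /param[u u0 ->] /param[v v0 ->].
rewrite !legendre_powR// => -[].
by move=> /(divIf (lt0r_neq0 a0)) /(mulIf (lt0r_neq0 a'0)) ->.
Qed.

End convex_conjugate.

(** * Comparing the quadratic forms of B and Psi(B) *)

Section functional_calculus.
Context {d : measure_display} {X : measurableType d} {R : realType}.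
Context {mu : {measure set X -> \bar R}}.
Variables (E : resolution mu) (Psi : R -> R) (B PsiB : operator mu).
Hypothesis Psi_gt0 : forall x, 0 < x -> 0 < Psi x.
Hypothesis Psi_nd : {in `]0, +oo[%classic &, {homo Psi : x y / x <= y}}.
Hypothesis E_B : spectral_resolution E B.
Hypothesis E_PsiB : is_functional_calculus E Psi PsiB.
Variables x z : R.
Hypotheses (x0 : 0 < x) (z0 : 0 <= z) (xz : legendre Psi x = z%:E).

Let mPsi : measurable_fun (`[0, +oo[ : set R) (ext0 Psi).
Proof.
by apply: nondecreasing_measurable => //; exact: ext0_nondecreasing.
Qed.

Let young l : (`[0, +oo[%classic : set R) l -> x * l <= ext0 Psi l + z.
Proof.
rewrite /= in_itv/= andbT.
by move=> /(fenchel_young_ext0 Psi_gt0 Psi_nd z0 xz).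
Qed.

Let id_ge0 l : (`[0, +oo[%classic : set R) l -> 0 <= l.
Proof. by rewrite /= in_itv/= andbT. Qed.

Let Psi_ge0 l : (`[0, +oo[%classic : set R) l -> 0 <= ext0 Psi l.
Proof. by move=> _; exact: ext0_ge0. Qed.

(** Psi grows at least linearly at infinity, by [young], so that square
    integrability of Psi forces that of the identity. *)
Lemma functional_calculus_dom f : dom PsiB f -> dom B f.
Proof.
move=> /(proj1 E_PsiB) Pf; apply/(proj1 E_B).
exact: (@dominated_sqr_lty _ (measurableTypeR R) _ (spectral_measure E f) _ _
  (spectral_mass_lty E f) (ext0 Psi) id x z).
Qed.

Let Rintegral_fenchel_young g : dom PsiB g ->
  x * \int[spectral_measure E g]_(l in `[0, +oo[) l <=
  \int[spectral_measure E g]_(l in `[0, +oo[) ext0 Psi l + z * inner g g.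
Proof.
move=> /(proj1 E_PsiB) Pg.
apply: (le_trans (@dominated_Rintegral _ (measurableTypeR R) _
  (spectral_measure E g) _ _ (spectral_mass_lty E g) (ext0 Psi) id x z
  mPsi (@measurable_id _ _ _) Psi_ge0 id_ge0 x0 young Pg)) => //.
apply: lerD; first exact: lexx.
apply: ler_wpM2l => //; rewrite -lee_fin fineK ?spectral_mass_le//.
by rewrite ge0_fin_numE ?spectral_mass_lty.
Qed.

(** The Fenchel-Young inequality is integrated against the spectral measure of
    f + f; the factor 4 between the squared norms of f + f and f cancels the
    one of the polarization formula. *)
Lemma inner_functional_calculus_ge f : dom PsiB f ->
  x * inner (B f) f <= inner (PsiB f) f + z * inner f f.
Proof.
move=> Pf; have Bf := functional_calculus_dom Pf.
have : dom PsiB (f + f) by rewrite -[X in X + _]scale1r; exact: dom_lin.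
move=> /Rintegral_fenchel_young; rewrite inner_double.
have -> : inner (PsiB f) f = spectral_form E (ext0 Psi) f f.
  exact: (proj2 E_PsiB).
have -> : inner (B f) f = spectral_form E id f f by exact: (proj2 E_B).
rewrite (spectral_form_diag _ f mPsi).
have -> : spectral_form E id f f =
    4^-1 * \int[spectral_measure E (f + f)]_(l in `[0, +oo[) l.
  exact: spectral_form_diag.
set I := \int[spectral_measure E (f + f)]_(l in `[0, +oo[) l.
set J := \int[spectral_measure E (f + f)]_(l in `[0, +oo[) ext0 Psi l.
move: I J => I J; lra.
Qed.

End functional_calculus.

(** * Transfer of the super-Poincare inequality *)

(** Each admissible [e] gives, by absorption of (1 - e) ||f||^2, a bound that is
    affine in the corresponding element of the set defining the rate, hence
    passes to its infimum. *)
Lemma super_poincare_rate {R : realType} {d : measure_display}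
    {X : measurableType d} {mu : {measure set X -> \bar R}}
    (B PsiB : operator mu) (E : resolution mu) (gamma Psi : R -> R) :
  spectral_resolution E B -> super_poincare B gamma ->
  (forall x, 0 < x -> 0 < Psi x) ->
  {in `]0, +oo[%classic &, {homo Psi : x y / x <= y}} ->
  set_surj `]0, +oo[%classic (EFin @` `]0, +oo[%classic) (legendre Psi) ->
  is_functional_calculus E Psi PsiB ->
  super_poincare PsiB (rate Psi gamma).
Proof.
move=> E_B B_sp Psi_gt0 Psi_nd Psi_surj E_PsiB f Pf f1 t t0.
rewrite /rate; set N := norm2 mu f ^+ 2; set Q := inner (PsiB f) f.
set c := norm1 mu f ^+ 2.
have c_ge0 : 0 <= c by exact: sqr_ge0.
set S := [set e^-1 * gamma (e * t * legendre_inv Psi ((1 - e) / (e * t))) |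
  e in `]0, 1[%classic].
suff bound v : S v -> N - t * Q <= v * c.
  have ne : S !=set0.
    eexists; exists 2^-1; last reflexivity.
    by rewrite /= in_itv/= invr_gt0 ltr0n invf_lt1// ltr1n.
  rewrite -lerBlDl; case: (ltP 0 c) => [c0|c_le0].
    rewrite -ler_pdivrMr//; apply: lb_le_inf => // v /bound.
    by rewrite ler_pdivrMr.
  have c0 : c = 0 by apply/eqP; rewrite eq_le c_le0.
  have [v /bound] := ne.
  by rewrite c0 !mulr0.
move=> [e /=]; rewrite in_itv/= => /andP[e0 e1] <-.
have et0 : 0 < e * t by rewrite mulr_gt0.
set z := (1 - e) / (e * t).
have z0 : 0 < z by rewrite divr_gt0// subr_gt0.
have [|x /= x0 xz] := Psi_surj z%:E.
  by exists z => //=; rewrite in_itv/= andbT.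
rewrite in_itv/= andbT in x0.
have [] := legendre_inv_spec x0 xz.
move: (legendre_inv Psi z) => y y0 yz {x x0 xz}.
have Bf := functional_calculus_dom Psi_gt0 Psi_nd E_B E_PsiB y0 (ltW z0) yz Pf.
have yB := inner_functional_calculus_ge Psi_gt0 Psi_nd E_B E_PsiB y0
  (ltW z0) yz Pf.
have fB := B_sp f Bf f1 (e * t * y) (mulr_gt0 et0 y0).
rewrite -norm2_sqr -/N -/Q in yB; rewrite -/N -/c in fB.
have etz : e * t * z = 1 - e by rewrite /z mulrC divfK ?gt_eqF.
have {}yB : e * t * y * inner (B f) f <= e * t * Q + (1 - e) * N.
  rewrite -etz -!(mulrA (e * t)) -mulrDr.
  by rewrite ler_pM2l.
have eN : e * (N - t * Q) <= gamma (e * t * y) * c by lra.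
by rewrite -mulrA -(ler_pM2l e0) mulVKf ?gt_eqF.
Qed.

(** At e = alpha the parameter of the conjugate is w = 1/t, so the argument of
    gamma is alpha t * w^(1-alpha) / alpha = t^alpha. *)
Lemma rate_powR_le {R : realType} (gamma : R -> R) (alpha t : R) :
  (forall r, 0 < r -> 0 < gamma r) -> 0 < alpha < 1 -> 0 < t ->
  rate (fun x => x `^ alpha^-1) gamma t <= alpha^-1 * gamma (t `^ alpha).
Proof.
move=> gamma_gt0 a01 t0; have /andP[a0 a1] := a01.
apply: ge_inf.
  (* The set is bounded below because each argument of gamma is positive. *)
  exists 0 => v [e /=]; rewrite in_itv/= => /andP[e0 e1] <-.
  have et0 : 0 < e * t by rewrite mulr_gt0.
  set z := (1 - e) / (e * t).
  have z0 : 0 < z by rewrite divr_gt0// subr_gt0.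
  have w0 : 0 < z * alpha / (1 - alpha).
    by rewrite !(divr_gt0, mulr_gt0)// subr_gt0.
  have -> : z = z * alpha / (1 - alpha) * (1 - alpha) / alpha.
    by field; rewrite !gt_eqF// subr_gt0.
  rewrite legendre_inv_powR//.
  have arg_gt0 : 0 < e * t *
      (alpha^-1 * (z * alpha / (1 - alpha)) `^ (1 - alpha)).
    by apply: mulr_gt0 => //; apply: mulr_gt0; rewrite ?invr_gt0 ?powR_gt0.
  by apply/ltW; rewrite mulr_gt0 ?invr_gt0 ?gamma_gt0.
exists alpha; first by rewrite /= in_itv.
have -> : (1 - alpha) / (alpha * t) = t^-1 * (1 - alpha) / alpha.
  by field; rewrite !gt_eqF.
rewrite legendre_inv_powR ?invr_gt0//.
congr (_ * gamma _).
have tV : t^-1 `^ (1 - alpha) = t `^ (alpha - 1).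
  by rewrite -(powR_inv1 (ltW t0)) -powRrM mulN1r opprB.
have -> : t `^ alpha = t * t `^ (alpha - 1).
  rewrite -{2}(powRr1 (ltW t0)) -powRD ?(gt_eqF t0) ?implybT//.
  by rewrite addrC subrK.
by rewrite tV; field; rewrite gt_eqF.
Qed.

Theorem theorem5p2 (R : realType) (d : measure_display) (X : measurableType d)
    (mu : {sigma_finite_measure set X -> \bar R})
    (B : operator mu) (E : resolution mu) (gamma : R -> R)
    (B_selfadjoint : self_adjoint B) (B_nonneg : nonneg_operator B)
    (E_B : spectral_resolution E B)
    (gamma_gt0 : forall r, 0 < r -> 0 < gamma r)
    (B_sp : super_poincare B gamma) :
  (forall (Psi : R -> R) (PsiB : operator mu),
     (forall x, 0 < x -> 0 < Psi x) ->
     {in `]0, +oo[%classic &, {homo Psi : x y / x <= y}} ->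
     convex_function (`]0, +oo[%classic : set R^o) Psi ->
     set_bij `]0, +oo[%classic (EFin @` `]0, +oo[%classic) (legendre Psi) ->
     is_functional_calculus E Psi PsiB ->
     super_poincare PsiB (rate Psi gamma)) /\
  (forall alpha : R, 0 < alpha < 1 ->
     forall t, 0 < t ->
       rate (fun x => x `^ alpha^-1) gamma t
         <= alpha^-1 * gamma (t `^ alpha)).
Proof.
split=> [Psi PsiB Psi_gt0 Psi_nd _ [_ _ Psi_surj] E_PsiB|alpha a01 t t0].
  exact: (super_poincare_rate E_B B_sp).
exact: rate_powR_le.
Qed.
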